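(* Let $(V,g)$ be a Euclidean real vector space of even dimension $n=2k\ge 2$ and let $R$ be a symmetric $(2,2)$ double form on $V$ satisfying the first Bianchi identity. Then $$T_n(R):=\frac{\mathrm c^{n}R^k}{n!}\,g-\frac{\mathrm c^{n-1}R^k}{(n-1)!}=0.$$
   Context: Let $(V,g)$ be a Euclidean real vector space of dimension $n$. A $(p,q)$ double form is an element of $\mathcal D^{p,q}=\Lambda^pV^*\otimes\Lambda^qV^*$, identified with a bilinear form $\Lambda^pV\times\Lambda^qV\to\mathbb R$. Exterior product: $(\theta_1\otimes\theta_2)(\theta_3\otimes\theta_4)=(\theta_1\wedge\theta_3)\otimes(\theta_2\wedge\theta_4)$, extended bilinearly; $R^k$ is the $k$-th power for this product; $g$ is regarded as a $(1,1)$ double form. Contraction $\mathrm c:\mathcal D^{p,q}\to\mathcal D^{p-1,q-1}$: $\mathrm c\,\omega(x_1\wedge\dots\wedge x_{p-1},y_1\wedge\dots\wedge y_{q-1})=\sum_{j=1}^n\omega(e_j\wedge x_1\wedge\dots\wedge x_{p-1},e_j\wedge y_1\wedge\dots\wedge y_{q-1})$ for any orthonormal basis $(e_j)$ of $V$; $\mathrm c^j$ is the $j$-fold iterate, and a $(0,0)$ double form is a scalar. A $(2,2)$ double form $R$ is symmetric if $R(u,v)=R(v,u)$ for $u,v\in\Lambda^2V$, and satisfies the first Bianchi identity if $\sum_{j=1}^{3}(-1)^jR(x_1\wedge\dots\widehat{x_j}\dots\wedge x_3,\;x_j\wedge y)=0$ for all $x_1,x_2,x_3,y\in V$. *)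

(* Defs.v *)
From HB Require Import structures.
From mathcomp Require Import all_boot all_order all_fingroup all_algebra.
From mathcomp Require Import boolp functions reals.

Set Implicit Arguments.
Unset Strict Implicit.
Unset Printing Implicit Defensive.

Import Order.TTheory GRing.Theory Num.Theory.
Local Open Scope ring_scope.

(* An element of the exterior algebra of V^* is encoded as a function on finite
   sequences: the value on [:: x_1; ...; x_p] is the value of the component of
   degree p on x_1 /\ ... /\ x_p.  In the same way, an element of the bigraded
   algebra of double forms is encoded as a function on pairs of finite
   sequences, and an element of D^{p,q} is one that vanishes unless the two
   sequences have sizes p and q. *)
Definition ext_form (R : realType) (V : vectType R) := seq V -> R^o.
Definition double_form (R : realType) (V : vectType R) := seq V -> seq V -> R^o.

Definition is_form (R : realType) (V : vectType R) (p : nat)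
    (theta : ext_form V) : Prop :=
  [/\ forall xs, size xs != p -> theta xs = 0,
      forall s t a u v, theta (s ++ (a *: u + v) :: t) =
                        a * theta (s ++ u :: t) + theta (s ++ v :: t)
    & forall s t r u, theta (s ++ u :: t ++ u :: r) = 0].

Definition is_double_form (R : realType) (V : vectType R) (p q : nat)
    (omega : double_form V) : Prop :=
  (forall ys, is_form p (omega ^~ ys)) /\ (forall xs, is_form q (omega xs)).

Definition permute (R : realType) (V : vectType R) (xs : seq V)
    (s : 'S_(size xs)) : seq V :=
  [seq xs`_(s i) | i : 'I_(size xs)].

(* Summand p is the usual antisymmetrization formula for the product of a form
   of degree p by a form of degree size xs - p, so for theta of degree p and
   eta of degree r only that summand is nonzero and the factor is 1/(p! r!). *)
Definition wedge (R : realType) (V : vectType R) (theta eta : ext_form V) :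
    ext_form V := fun xs =>
  \sum_(p < (size xs).+1) (p`! * (size xs - p)`!)%:R^-1 *
    \sum_(s : 'S_(size xs))
      (-1) ^+ s * theta (take p (permute s)) * eta (drop p (permute s)).

Definition tensor (R : realType) (V : vectType R) (theta1 theta2 : ext_form V) :
    double_form V := fun xs ys => theta1 xs * theta2 ys.

(* The bilinear extension of the product of decomposable double forms; see
   dmul_tensor, dmulDZl and dmulDZr. *)
Definition dmul (R : realType) (V : vectType R) (w1 w2 : double_form V) :
    double_form V := fun xs ys =>
  \sum_(p < (size xs).+1) \sum_(q < (size ys).+1)
    ((p`! * (size xs - p)`!)%:R^-1 * (q`! * (size ys - q)`!)%:R^-1) *
    \sum_(s : 'S_(size xs)) \sum_(t : 'S_(size ys))
      (-1) ^+ s * (-1) ^+ t * w1 (take p (permute s)) (take q (permute t)) *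
      w2 (drop p (permute s)) (drop q (permute t)).

Lemma dmul_tensor (R : realType) (V : vectType R)
    (theta1 theta2 theta3 theta4 : ext_form V) :
  dmul (tensor theta1 theta2) (tensor theta3 theta4) =
  tensor (wedge theta1 theta3) (wedge theta2 theta4).
Proof.
apply/funext => xs; apply/funext => ys; rewrite /dmul /tensor /wedge.
rewrite big_distrlr /=; apply: eq_bigr => p _; apply: eq_bigr => q _.
rewrite mulrACA; congr (_ * _).
rewrite big_distrlr /=; apply: eq_bigr => s _; apply: eq_bigr => t _.
by rewrite [RHS]mulrACA [in RHS](mulrACA ((-1) ^+ s)) -!mulrA.
Qed.

Lemma dmulDZl (R : realType) (V : vectType R) (a : R)
    (w w1 w2 : double_form V) :
  dmul (a *: w1 + w2) w = a *: dmul w1 w + dmul w2 w.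
Proof.
apply/funext => xs; apply/funext => ys; apply/eqP; rewrite eq_sym; apply/eqP.
rewrite -[LHS]/(a * (_ : double_form V) xs ys + (_ : double_form V) xs ys).
rewrite mulr_sumr -big_split; apply: eq_bigr => p _ /=.
rewrite mulr_sumr -big_split; apply: eq_bigr => q _ /=.
rewrite mulrCA -mulrDr; congr (_ * _).
rewrite mulr_sumr -big_split; apply: eq_bigr => s _ /=.
rewrite mulr_sumr -big_split; apply: eq_bigr => t _ /=.
by rewrite -[(_ + w2) _ _]/(a * w1 _ _ + w2 _ _) mulrDr mulrDl !mulrA
  [a * _]mulrC -!mulrA ?(mulrCA a).
Qed.

Lemma dmulDZr (R : realType) (V : vectType R) (a : R)
    (w w1 w2 : double_form V) :
  dmul w (a *: w1 + w2) = a *: dmul w w1 + dmul w w2.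
Proof.
apply/funext => xs; apply/funext => ys; apply/eqP; rewrite eq_sym; apply/eqP.
rewrite -[LHS]/(a * (_ : double_form V) xs ys + (_ : double_form V) xs ys).
rewrite mulr_sumr -big_split; apply: eq_bigr => p _ /=.
rewrite mulr_sumr -big_split; apply: eq_bigr => q _ /=.
rewrite mulrCA -mulrDr; congr (_ * _).
rewrite mulr_sumr -big_split; apply: eq_bigr => s _ /=.
rewrite mulr_sumr -big_split; apply: eq_bigr => t _ /=.
by rewrite -[(_ + w2) _ _]/(a * w1 _ _ + w2 _ _) mulrDr mulrCA.
Qed.

Definition dunit (R : realType) (V : vectType R) : double_form V :=
  fun xs ys => ((xs == [::]) && (ys == [::]))%:R.

Definition dexp (R : realType) (V : vectType R) (w : double_form V) (k : nat) :
    double_form V := iter k (dmul w) (@dunit R V).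

Definition metric_form (R : realType) (V : vectType R)
    (g : {dot V for idfun}) : double_form V := fun xs ys =>
  if (xs, ys) is ([:: x], [:: y]) then g x y else 0.

Definition orthonormal_basis (R : realType) (V : vectType R)
    (g : {dot V for idfun}) (e : seq V) : bool :=
  basis_of {:V} e && orthonormal g e.

Lemma orthonormal_basis_exists (R : realType) (V : vectType R)
    (g : {dot V for idfun}) : exists e, orthonormal_basis g e.
Proof.
have symg x y : g x y = g y x by rewrite (hermC g) expr0 mul1r.
have gZ x a y : g x (a *: y) = a * g x y by rewrite linearZ.
have onP (s : seq V) : orthonormal g s ->
    uniq s /\ {in s &, forall x y, g x y = (x == y)%:R}.
  elim: s => [|x s IHs] //= /andP[/= /andP[/eqP xx s1]].
  rewrite /ortho_rec /= andbT => /andP[/allP xs s2].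
  have [|us os] := IHs; first by rewrite /orthonormal s1.
  have xns y : y \in s -> x != y.
    move=> ys; apply: contraTneq (xs y ys) => <-.
    by rewrite /= xx oner_eq0.
  split; first by rewrite us andbT; apply/negP => /xns; rewrite eqxx.
  move=> y z; rewrite !inE => /orP[/eqP->|ys] /orP[/eqP->|zs].
  - by rewrite eqxx.
  - by rewrite (negbTE (xns _ zs)); apply/eqP/xs.
  - by rewrite symg eq_sym (negbTE (xns _ ys)); apply/eqP/xs.
  - exact: os.
have gfree (s : seq V) : orthonormal g s -> free s.
  case/onP => us os; rewrite -(in_tupleE s); apply/freeP => a as0 i.
  have si : s`_i \in s by apply: mem_nth.
  have : g s`_i 0 = 0 by rewrite linear0r.
  rewrite -[X in g _ X]as0 linear_sumr (bigD1 i) //= big1 => [|j ji].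
    by rewrite gZ os// eqxx mulr1 addr0.
  by rewrite gZ os ?mem_nth// nth_uniq// (inj_eq val_inj) eq_sym (negbTE ji) mulr0.
suff [e es eo] : exists2 e : seq V, size e = \dim {:V} & orthonormal g e.
  by exists e; rewrite /orthonormal_basis eo basisEfree gfree// subvf es leqnn.
elim: {1 3}(\dim {:V}) (leqnn (\dim {:V})) => [|d IH] dV; first by exists [::].
have [s ss so] := IH (ltnW dV).
have [us os] := onP s so.
have /subvPn[v _ vs] : ~~ ({:V} <= <<s>>)%VS.
  by apply/negP => /dimvS /(leq_trans dV); rewrite leqNgt ltnS -ss dim_span.
pose w := \sum_(x <- s) g v x *: x; pose u := v - w.
have ws : w \in <<s>>%VS.
  by rewrite /w big_seq; apply: memv_suml => x xs; rewrite memvZ// memv_span.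
have u0 : u != 0 by apply: contra vs; rewrite subr_eq0 => /eqP ->.
have us0 x : x \in s -> g x u = 0.
  move=> xs; rewrite linearBr linear_sumr (bigD1_seq x)//= big1_seq.
    by rewrite addr0 gZ os// eqxx mulr1 (symg x v) subrr.
  by move=> y /andP[yx ys]; rewrite gZ os// eq_sym (negbTE yx) mulr0.
have gu : 0 < g u u by apply: neq0_dnorm_gt0.
exists ((Num.sqrt (g u u))^-1 *: u :: s); first by rewrite /= ss.
case/andP: so => so1 so2; apply/andP; split=> /=.
  rewrite so1 andbT gZ symg gZ mulrA -expr2 exprVn sqr_sqrtr ?ltW//.
  by rewrite mulVf// gt_eqF.
rewrite so2 !andbT; apply/allP => x xs /=.
by rewrite symg gZ us0// mulr0.
Qed.

Definition contraction (R : realType) (V : vectType R) (e : seq V)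
    (w : double_form V) : double_form V := fun xs ys =>
  \sum_(v <- e) w (v :: xs) (v :: ys).

Definition iter_contraction (R : realType) (V : vectType R) (e : seq V)
    (j : nat) (w : double_form V) : double_form V := iter j (contraction e) w.

(* The scalar identified with a double form of bidegree (0,0). *)
Definition scalar_part (R : realType) (V : vectType R) (w : double_form V) : R :=
  w [::] [::].

Definition symmetric_double_form (R : realType) (V : vectType R)
    (w : double_form V) : Prop := forall xs ys, w xs ys = w ys xs.

Definition first_Bianchi (R : realType) (V : vectType R)
    (w : double_form V) : Prop := forall x1 x2 x3 y,
  - w [:: x2; x3] [:: x1; y] + w [:: x1; x3] [:: x2; y]
  - w [:: x1; x2] [:: x3; y] = 0.

(* Main.v *)
(** The power R^k is a double form w of top bidegree (n,n).  Evaluated on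
    sequences from the orthonormal basis e, w vanishes unless both sequences
    are permutations of e, and w(xs, xs) is unchanged when the basis vectors
    are permuted, since the sign occurs twice.  Both properties are inherited
    by contractions, so the (1,1) form c^{n-1} w is diagonal in e with equal
    diagonal entries, i.e. a multiple of g; taking one more trace determines
    the multiple. *)
Require Import Defs.
From mathcomp Require Import all_boot all_order all_fingroup all_algebra.
From mathcomp Require Import boolp functions reals.

Import Order.TTheory GRing.Theory Num.Theory.
Local Open Scope ring_scope.

(** * Alternating forms and the sign of a rearrangement of their arguments *)

Section Forms.
Context {R : realType} {V : vectType R}.
Implicit Types (theta eta : ext_form V) (w : double_form V) (p q r : nat).

Lemma is_form_eq p {theta} eta : theta =1 eta -> is_form p theta -> is_form p eta.
Proof. by move=> /funext ->. Qed.

Lemma is_form_sum (I : Type) (rI : seq I) (P : pred I) (a : I -> R)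
    (F : I -> ext_form V) p :
  (forall i, P i -> is_form p (F i)) ->
  is_form p (fun xs => \sum_(i <- rI | P i) a i * F i xs).
Proof.
move=> formF; split=> [xs szxs|s t b u v|s t z u].
- by rewrite big1// => i /formF[F0 _ _]; rewrite F0// mulr0.
- rewrite mulr_sumr -big_split; apply: eq_bigr => i /formF[_ Flin _] /=.
  by rewrite Flin mulrDr mulrCA.
- by rewrite big1// => i /formF[_ _ Falt]; rewrite Falt mulr0.
Qed.

Lemma is_form_nuniq p theta xs : is_form p theta -> ~~ uniq xs -> theta xs = 0.
Proof.
move=> [_ _ alt]; suff H s : ~~ uniq xs -> theta (s ++ xs) = 0 by exact: (H [::]).
elim: xs s => [//|x xs IH] s; rewrite cons_uniq negb_and negbK => /orP[|nu].
  by case/splitPr=> t z; apply: alt.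
by rewrite -cat_rcons IH.
Qed.

(** Polarization: expand the vanishing value at the repeated argument [u + v]; the two diagonal
    terms vanish as well. *)
Lemma is_form_swap p theta s u v t : is_form p theta ->
  theta (s ++ u :: v :: t) = - theta (s ++ v :: u :: t).
Proof.
move=> [_ lin alt].
have D1 a b z : theta (s ++ (a + b) :: z) = theta (s ++ a :: z) + theta (s ++ b :: z).
  by have := lin s z 1 a b; rewrite scale1r mul1r.
have D2 c a b : theta (s ++ c :: (a + b) :: t)
    = theta (s ++ c :: a :: t) + theta (s ++ c :: b :: t).
  by have := lin (rcons s c) t 1 a b; rewrite scale1r mul1r !cat_rcons.
have alt2 c : theta (s ++ c :: c :: t) = 0 by exact: (alt s [::] t c).
have := alt2 (u + v); rewrite D1 !D2 !alt2 add0r addr0 => /eqP.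
by rewrite addr_eq0 => /eqP.
Qed.

(** Each entry of [t1] crosses each entry of [t2] once, at the cost of one adjacent swap. *)
Lemma is_form_catCA p theta s t1 t2 z : is_form p theta ->
  theta (s ++ t1 ++ t2 ++ z) =
  (-1) ^+ (size t1 * size t2) * theta (s ++ t2 ++ t1 ++ z).
Proof.
move=> form; elim: t1 s => [|u t1 IH] s; first by rewrite /= mul1r.
have move1 x l : theta (x ++ u :: t2 ++ l) =
    (-1) ^+ size t2 * theta (x ++ t2 ++ u :: l).
  elim: t2 {IH} x => [|v t2 IH2] x; first by rewrite /= mul1r.
  rewrite /= (is_form_swap _ _ _ _ _ _ form) -cat_rcons IH2 cat_rcons.
  by rewrite exprS mulN1r mulNr.
by rewrite cat_cons -cat_rcons IH cat_rcons move1 mulrA -exprD mulSn addnC.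
Qed.

(** Any rearrangement is built from exchanges of adjacent blocks. The exponent is chosen before the
    form, so that one sign serves for forms in either argument of a double form. *)
Lemma is_form_perm {xs ys : seq V} : perm_eq xs ys ->
  exists m : nat, forall p theta, is_form p theta ->
    theta ys = (-1) ^+ m * theta xs.
Proof.
move=> xys.
pose P (zs : seq V) := exists m : nat, forall p theta, is_form p theta ->
    theta zs = (-1) ^+ m * theta xs.
have: P xs by exists 0%N => p theta _; rewrite mul1r.
move: xys; rewrite -/(P ys); apply: catCA_perm_ind => s1 s2 s3 [m IH].
exists ((size s2 * size s1) + m)%N => p theta form.
by rewrite exprD -mulrA -(IH _ _ form) (is_form_catCA _ _ [::] _ _ _ form).
Qed.

(** * Products and contractions preserve multilinearity and alternation *)

Lemma sum_permute {N} {xs : seq V} (F : seq V -> R) : size xs = N ->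
  \sum_(s : 'S_(size xs)) (-1) ^+ s * F (permute s) =
  \sum_(s : 'S_N) (-1) ^+ s * F [seq xs`_(s i) | i : 'I_N].
Proof. by move=> <-. Qed.

Lemma perm_seq_split {N} (s : 'S_N) {m} : (m < N)%N -> exists A B : seq nat,
  [/\ [seq val (s i) | i : 'I_N] = A ++ m :: B, m \notin A & m \notin B].
Proof.
move=> mN; have : m \in [seq val (s i) | i : 'I_N].
  by apply/mapP; exists (s^-1%g (Ordinal mN)); rewrite ?mem_enum// permKV.
have : uniq [seq val (s i) | i : 'I_N].
  by rewrite map_inj_uniq ?enum_uniq// => i j /val_inj /perm_inj.
move=> + mS; case/splitPr: mS => A B.
rewrite cat_uniq /= => /and3P[_ /norP[mA _] /andP[mB _]].
by exists A, B.
Qed.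

(** The cut at [i] leaves the varying slot in exactly one of the two factors; when [i = size s] it
    is the head of the second one. *)
Lemma is_form_tensor_linear {p r theta eta} i s t a u v :
    is_form p theta -> is_form r eta ->
  let F zs := theta (take i zs) * eta (drop i zs) in
  F (s ++ (a *: u + v) :: t) = a * F (s ++ u :: t) + F (s ++ v :: t).
Proof.
move=> [_ lin1 _] [_ lin2 _] F; rewrite /F !take_cat !drop_cat.
case: ltnP => si; first by rewrite lin2 mulrDr mulrCA.
case: (i - size s)%N => [|j] /=; last by rewrite lin1 mulrDl mulrA.
by rewrite cats0 (lin2 [::]) mulrDr mulrCA.
Qed.

Lemma wedge_is_form p r theta eta :
  is_form p theta -> is_form r eta -> is_form (p + r) (wedge theta eta).
Proof.
move=> form1 form2.
pose F i zs := theta (take i zs) * eta (drop i zs).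
(* The index type ['S_(size xs)] depends on the arguments; a fixed [N] lets sums for different
   sequences be compared term by term. *)
have wE N xs : size xs = N -> wedge theta eta xs =
  \sum_(i < N.+1) (i`! * (N - i)`!)%:R^-1 *
    \sum_(s : 'S_N) (-1) ^+ s * F i [seq xs`_(s j) | j : 'I_N].
  move=> szxs; rewrite /wedge; case: N / szxs; apply: eq_bigr => i _.
  by congr (_ * _); apply: eq_bigr => s _; rewrite mulrA.
have [th0 _ _] := form1; have [et0 _ _] := form2.
split=> [xs szxs|s t a u v|s t z u].
- rewrite (wE _ _ erefl) big1// => i _; rewrite big1 ?mulr0// => s _.
  set zs := [seq _ | _ in _].
  have szs : size zs = size xs by rewrite size_map size_enum_ord.
  (* If the prefix has size [p], the suffix cannot have size [r], since the total is not [p + r]. *)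
  rewrite /F; have [ip|ip] := eqVneq (size (take i zs)) p; last first.
    by rewrite th0// mul0r mulr0.
  rewrite et0 ?mulr0// -(eqn_add2l p) -{1}ip -size_cat cat_take_drop szs.
  exact: szxs.
- pose N := (size s + size t).+1.
  have szN x : size (s ++ x :: t) = N by rewrite size_cat /= addnS.
  rewrite !(wE N)// mulr_sumr -big_split; apply: eq_bigr => i _ /=.
  rewrite mulrCA -mulrDr; congr (_ * _).
  rewrite mulr_sumr -big_split; apply: eq_bigr => /= sg _.
  rewrite (mulrCA a) -mulrDr; congr (_ * _).
  have sN : (size s < N)%N by rewrite ltnS leq_addr.
  (* The slot size s occurs exactly once in the permuted sequence. *)
  have [A [B [sgE sA sB]]] := perm_seq_split sg sN.
  (* Putting [0] in the slot makes the two outer pieces visibly independent of [x]; that slot is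
     never read there. *)
  have nthE x : [seq (s ++ x :: t)`_(sg j) | j : 'I_N] =
      [seq (s ++ 0 :: t)`_j | j <- A] ++ x :: [seq (s ++ 0 :: t)`_j | j <- B].
    transitivity [seq (s ++ x :: t)`_j | j <- [seq val (sg j) | j : 'I_N]].
      by rewrite -map_comp.
    have nx j : j != size s -> (s ++ x :: t)`_j = (s ++ 0 :: t)`_j.
      rewrite !nth_cat; case: ltnP => // sj js.
      by case E: (j - size s)%N => //; rewrite eqn_leq -subn_eq0 E sj in js.
    rewrite sgE map_cat /= nth_cat ltnn subnn /=.
    by congr (_ ++ _ :: _); apply/eq_in_map => j jAB; apply: nx;
      [apply: contraNneq sA|apply: contraNneq sB] => <-.
  by rewrite !nthE; exact: (is_form_tensor_linear i _ _ a u v form1 form2).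
- set xs := s ++ _; rewrite (wE _ _ erefl) big1// => i _.
  have li : (size s < size xs)%N by rewrite size_cat /= addnS ltnS leq_addr.
  have lj : (size s + (size t).+1 < size xs)%N.
    by rewrite !size_cat /= size_cat /= ltn_add2l ltnS -addn1 leq_add2l.
  pose a := Ordinal li; pose b := Ordinal lj.
  have ab : a != b by rewrite -val_eqE /= -[X in X == _]addn0 eqn_add2l.
  have xsab j : xs`_(tperm a b j) = xs`_j.
    have xa : xs`_a = u by rewrite nth_cat ltnn subnn.
    have xb : xs`_b = u.
      rewrite nth_cat ltnNge leq_addr /= addKn /=.
      by rewrite nth_cat ltnn subnn.
    by case: tpermP => [->|->|//]; rewrite xa xb.
  set S := \sum_(s : _) _; suff : S = - S.
    by move/eqP; rewrite -addr_eq0 -mulr2n mulrn_eq0 /= => /eqP ->; rewrite mulr0.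
  (* Transposing two equal arguments changes only the sign of each summand. *)
  rewrite {1}/S (reindex_inj (mulIg (tperm a b))) /= -sumrN.
  apply: eq_bigr => sg _; rewrite odd_permM odd_tperm ab addbT signrN mulNr.
  congr (- (_ * F i _)); apply: eq_map => j; rewrite permM; exact: xsab.
Qed.

(** For fixed [ys], the product is a linear combination of wedge products of forms in the first
    argument, so [wedge_is_form] applies. *)
Lemma dmul_is_form_left p q p' q' w1 w2 :
    is_double_form p q w1 -> is_double_form p' q' w2 ->
  forall ys, is_form (p + p') (dmul w1 w2 ^~ ys).
Proof.
move=> [f1 _] [f2 _] ys.
pose a (j : 'I_(size ys).+1) : R := (j`! * (size ys - j)`!)%:R^-1.
pose W (j : 'I_(size ys).+1) (t : 'S_(size ys)) : ext_form V :=
  wedge (w1 ^~ (take j (permute t))) (w2 ^~ (drop j (permute t))).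
apply: (@is_form_eq _ (fun xs => \sum_(j < (size ys).+1) a j *
  \sum_(t : 'S_(size ys)) (-1) ^+ t * W j t xs)).
  move=> xs; rewrite /dmul exchange_big /=; apply: eq_bigr => j _.
  under eq_bigr do rewrite [_^-1 * _^-1]mulrC -mulrA.
  rewrite -mulr_sumr; congr (_ * _).
  transitivity (\sum_(t : 'S_(size ys)) \sum_(i < (size xs).+1)
     (-1) ^+ t * ((i`! * (size xs - i)`!)%:R^-1 *
       \sum_(s : 'S_(size xs)) (-1) ^+ s
         * w1 (take i (permute s)) (take j (permute t))
         * w2 (drop i (permute s)) (drop j (permute t)))).
    by apply: eq_bigr => t _; rewrite -mulr_sumr.
  rewrite exchange_big /=; apply: eq_bigr => i _.
  under eq_bigr do rewrite mulrCA.
  rewrite -mulr_sumr; congr (_ * _); rewrite exchange_big /=.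
  apply: eq_bigr => t _; rewrite mulr_sumr; apply: eq_bigr => s _.
  by rewrite !mulrA [_ ^+ s * _]mulrC.
by apply: is_form_sum => j _; apply: is_form_sum => t _; apply: wedge_is_form.
Qed.

(** Exchanging the two arguments carries results on the first one over to the second. *)
Lemma dmul_flip w1 w2 xs ys :
  dmul w1 w2 xs ys = dmul (fun x y => w1 y x) (fun x y => w2 y x) ys xs.
Proof.
rewrite /dmul exchange_big /=; apply: eq_bigr => i _; apply: eq_bigr => j _.
rewrite [_^-1 * _]mulrC; congr (_ * _); rewrite exchange_big /=.
by apply: eq_bigr => t _; apply: eq_bigr => s _; rewrite [_ ^+ s * _]mulrC.
Qed.

Lemma dmul_is_double_form p q p' q' w1 w2 :
    is_double_form p q w1 -> is_double_form p' q' w2 ->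
  is_double_form (p + p') (q + q') (dmul w1 w2).
Proof.
move=> f1 f2; split=> [|xs]; first exact: dmul_is_form_left f1 f2.
apply: is_form_eq (dmul_is_form_left q p q' p' _ _ _ _ xs).
- by move=> ys; rewrite -dmul_flip.
- by case: f1.
- by case: f2.
Qed.

Lemma dexp_is_double_form p q w k :
  is_double_form p q w -> is_double_form (k * p) (k * q) (dexp w k).
Proof.
move=> fw; elim: k => [|k IH]; last by rewrite !mulSn; apply: dmul_is_double_form.
split=> ?; rewrite /= /dunit; split=> [[|? ?]//= _|[|? ?] *|[|? ?] *];
  by rewrite /= ?andbF /= ?mulr0 ?addr0.
Qed.

Lemma contraction_is_double_form p q e w :
  is_double_form p.+1 q.+1 w -> is_double_form p q (contraction e w).
Proof.
move=> [f1 f2]; split=> [ys|xs].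
  apply: (@is_form_eq _ (fun xs => \sum_(v <- e) 1 * w (v :: xs) (v :: ys))).
    by move=> xs; apply: eq_bigr => v _; rewrite mul1r.
  apply: is_form_sum => v _; have [f0 fl fa] := f1 (v :: ys).
  by split=> [xs|s|s]; [exact: (f0 (v :: xs))|exact: (fl (v :: s))|exact: (fa (v :: s))].
apply: (@is_form_eq _ (fun ys => \sum_(v <- e) 1 * w (v :: xs) (v :: ys))).
  by move=> ys; apply: eq_bigr => v _; rewrite mul1r.
apply: is_form_sum => v _; have [f0 fl fa] := f2 (v :: xs).
by split=> [ys|s|s]; [exact: (f0 (v :: ys))|exact: (fl (v :: s))|exact: (fa (v :: s))].
Qed.

Lemma iter_contraction_is_double_form j p q e w :
  is_double_form (j + p) (j + q) w -> is_double_form p q (iter_contraction e j w).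
Proof.
elim: j p q => [//|j IH] p q fw; apply: contraction_is_double_form.
by apply: IH; rewrite !addnS -!addSn.
Qed.

(** * Vanishing and invariance properties on basis vectors *)

Definition balanced_on (e : seq V) w := forall xs ys : seq V,
  all (mem e) xs -> all (mem e) ys -> ~~ perm_eq xs ys -> w xs ys = 0.

Definition diag_invariant_on (e : seq V) (f : V -> V) w := forall xs : seq V,
  all (mem e) xs -> w (map f xs) (map f xs) = w xs xs.

(** Contraction prefixes the same vector to both sequences, which does not affect whether they are
    permutations of each other. Comparing [xs] with [ys] rather than with [e] is what lets the
    property pass to lower degrees. *)
Lemma iter_contraction_balanced e j w :
  balanced_on e w -> balanced_on e (iter_contraction e j w).
Proof.
move=> bw; elim: j => [//|j IH] xs ys xe ye nxy.
rewrite /= /contraction big_seq big1// => v ve; apply: IH; rewrite ?perm_cons//=.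
  exact/andP.
exact/andP.
Qed.

(** Since [f] permutes [e], the trace can be reindexed along [f], after which invariance applies to
    the longer sequence. *)
Lemma iter_contraction_diag_invariant e f j w : perm_eq (map f e) e ->
  diag_invariant_on e f w -> diag_invariant_on e f (iter_contraction e j w).
Proof.
move=> fe iw; elim: j => [//|j IH] xs xe.
rewrite /= /contraction -(perm_big _ fe) /= big_map !big_seq.
by apply: eq_bigr => v ve; apply: (IH (v :: xs)); apply/andP.
Qed.

Section TopDegree.
Variables (e : seq V) (w : double_form V).
Hypothesis e_uniq : uniq e.
Hypothesis w_form : is_double_form (size e) (size e) w.

Lemma uniq_size_perm xs : uniq xs -> all (mem e) xs -> size xs = size e ->
  perm_eq xs e.
Proof.
move=> ux /allP xe sx; apply: uniq_perm => //.
by have := uniq_min_size ux xe; rewrite sx leqnn => -[].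
Qed.

(** A nonzero value forces each sequence to consist of [size e] distinct members of [e], so both are
    permutations of [e]. *)
Lemma top_form_balanced : balanced_on e w.
Proof.
case: w_form => f1 f2 xs ys xe ye; apply: contraNeq => w0.
have ux : uniq xs by apply: contraNT w0 => /(is_form_nuniq _ _ _ (f1 ys)) ->.
have uy : uniq ys by apply: contraNT w0 => /(is_form_nuniq _ _ _ (f2 xs)) ->.
have sx : size xs = size e.
  by apply/eqP; apply: contraNT w0; case: (f1 ys) => + _ _ => /[apply] ->.
have sy : size ys = size e.
  by apply/eqP; apply: contraNT w0; case: (f2 xs) => + _ _ => /[apply] ->.
by rewrite (permPl (uniq_size_perm _ ux xe sx)) perm_sym uniq_size_perm.
Qed.

Lemma top_form_diag_invariant f : injective f -> perm_eq (map f e) e ->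
  diag_invariant_on e f w.
Proof.
case: w_form => f1 f2 injf fe xs xe.
have fxe : all (mem e) (map f xs).
  apply/allP => _ /mapP[x xxs ->].
  by rewrite inE -(perm_mem fe) map_f//; exact: (allP xe).
(* A repetition or a wrong length passes from [xs] to its image and makes both sides zero; what
   remains lists all of [e]. *)
have [ux|nux] := boolP (uniq xs); last first.
  by rewrite !(is_form_nuniq _ _ _ (f1 _)) ?(map_inj_uniq injf).
have [sx|nsx] := eqVneq (size xs) (size e); last first.
  by rewrite !(let: And3 f0 _ _ := f1 _ in f0) ?size_map.
have ufx : uniq (map f xs) by rewrite (map_inj_uniq injf).
have xfx : perm_eq xs (map f xs).
  rewrite (permPl (uniq_size_perm _ ux xe sx)) perm_sym.
  by rewrite uniq_size_perm ?size_map.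
have [m mE] := is_form_perm xfx.
(* The same sign (-1)^m comes out of both arguments, since m depends on the
   sequences only and not on the form. *)
rewrite (mE _ _ (f1 _)) (mE _ _ (f2 _)) mulrA -exprD addnn -mul2n exprM.
by rewrite sqrrN expr1n expr1n mul1r.
Qed.

End TopDegree.

(** Apply the invariance to the transposition of [a] and [b], extended by the identity to a
    bijection of [V]; this map of vectors is not meant to be linear. *)
Lemma diag_invariant_swap e w : uniq e ->
    (forall f, injective f -> perm_eq (map f e) e -> diag_invariant_on e f w) ->
  {in e &, forall a b, w [:: a] [:: a] = w [:: b] [:: b]}.
Proof.
move=> ue inv a b ae be.
pose f x := if x == a then b else if x == b then a else x.
have fK : involutive f.
  move=> x; rewrite /f; have [->|xa] := eqVneq x a.
    by rewrite eqxx; case: eqVneq.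
  by have [->|xb] := eqVneq x b; rewrite ?eqxx// (negbTE xa) (negbTE xb).
have fe : {homo f : x / x \in e} by move=> x; rewrite /f; do 2?case: ifP.
have mfe : perm_eq (map f e) e.
  apply: uniq_perm; rewrite ?(map_inj_uniq (inv_inj fK))// => x.
  apply/mapP/idP => [[y /fe + ->//]|xe].
  by exists (f x); rewrite ?fK ?fe.
by have := inv f (inv_inj fK) mfe [:: a]; rewrite /= ae /f eqxx => ->.
Qed.

(** * Recovering a (1,1) form from its values on an orthonormal basis *)

Lemma eq_on_spanning (e : seq V) (f h : V -> R) :
    linear_for *%R f -> linear_for *%R h ->
  (<<e>> = fullv)%VS -> {in e, f =1 h} -> f =1 h.
Proof.
move=> lf lh e_span fh x.
have D (k : V -> R) : linear_for *%R k -> forall (a : 'I_(size e) -> R),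
    k (\sum_i a i *: e`_i) = \sum_i a i * k e`_i.
  (* The vanishing at [0] is linearity with coefficient [-1] and both vectors zero. *)
  move=> lk a; have k0 : k 0 = 0.
    by have := lk (-1) 0 0; rewrite scaler0 addr0 mulN1r addNr.
  apply: (big_rec2 (fun y z => k y = z)) => // i z y _ <-; exact: lk.
have : x \in <<in_tuple e>>%VS by rewrite e_span memvf.
move/coord_span => ->; rewrite !D//; apply: eq_bigr => i _.
by rewrite fh// mem_nth.
Qed.

Lemma double_form11_linearl w y : is_double_form 1 1 w ->
  linear_for *%R (fun x => w [:: x] [:: y]).
Proof. by move=> [f1 _] a u v; case: (f1 [:: y]) => _ /(_ [::] [::] a u v). Qed.

Lemma double_form11_linearr w x : is_double_form 1 1 w ->
  linear_for *%R (fun y => w [:: x] [:: y]).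
Proof. by move=> [_ f2] a u v; case: (f2 [:: x]) => _ /(_ [::] [::] a u v). Qed.

End Forms.

Section OrthonormalBasis.
Context {R : realType} {V : vectType R} {g : {dot V for idfun}} {e : seq V}.
Hypothesis e_onb : orthonormal_basis g e.

Lemma dot_symm x y : g x y = g y x.
Proof. by rewrite (hermC g) expr0 mul1r. Qed.

(** The recursive predicate [orthonormal] tests each vector only against later ones; symmetry of [g]
    supplies the other order. *)
Lemma orthonormal_basis_dot : {in e &, forall x y, g x y = (x == y)%:R}.
Proof.
have /andP[_] := e_onb; elim: (e) => [|x s IHs] //= /andP[/= /andP[/eqP xx s1]].
rewrite /ortho_rec /= andbT => /andP[/allP xs s2].
have os := IHs (introT andP (conj s1 s2)).
have xns y : y \in s -> x != y.
  move=> ys; apply: contraTneq (xs y ys) => <-.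
  by rewrite /= xx oner_eq0.
move=> y z; rewrite !inE => /orP[/eqP->|ys] /orP[/eqP->|zs].
- by rewrite eqxx.
- by rewrite (negbTE (xns _ zs)); apply/eqP/xs.
- by rewrite dot_symm eq_sym (negbTE (xns _ ys)); apply/eqP/xs.
- exact: os.
Qed.

Lemma double_form11_scalar w c : is_double_form 1 1 w ->
    {in e &, forall a b, w [:: a] [:: b] = c * (a == b)%:R} ->
  w = c *: metric_form g.
Proof.
move=> fw wE; have [f1 f2] := fw.
have e_span : (<<e>> = fullv)%VS by have /andP[/andP[/eqP]] := e_onb.
apply/funext => xs; apply/funext => ys.
rewrite -[RHS]/(c * metric_form g xs ys).
have szx us vs : size us != 1%N -> w us vs = 0 by case: (f1 vs) => + _ _; apply.
have szy us vs : size vs != 1%N -> w us vs = 0 by case: (f2 us) => + _ _; apply.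
case: xs ys => [|x [|x' xs]] [|y [|y' ys]] /=; rewrite ?mulr0; try exact: szx;
  try exact: szy.
have glin a u v z : g z (a *: u + v) = a * g z u + g z v by rewrite linearPr.
(* Linear extension in the first argument, for fixed [y]; the second argument is then treated with
   the first in [e]. *)
apply: (eq_on_spanning e (fun x => w [:: x] [:: y]) (fun x => c * g x y) _ _ e_span).
- exact: double_form11_linearl.
- by move=> a u v /=; rewrite !(dot_symm _ y) glin mulrDr mulrCA.
move=> a ae /=.
apply: (eq_on_spanning e (fun y => w [:: a] [:: y]) (fun y => c * g a y) _ _ e_span).
- exact: double_form11_linearr.
- by move=> b u v /=; rewrite glin mulrDr mulrCA.
by move=> b be /=; rewrite wE// orthonormal_basis_dot.
Qed.

End OrthonormalBasis.

Theorem proposition3p5 (R : realType) (V : vectType R) (g : {dot V for idfun})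
    (n k : nat) (dimV : \dim {:V} = n) (n_even : n = (2 * k)%N)
    (n_ge2 : (2 <= n)%N) (e : seq V) (e_onb : orthonormal_basis g e)
    (Rm : double_form V) (Rm_form : is_double_form 2 2 Rm)
    (Rm_sym : symmetric_double_form Rm) (Rm_Bianchi : first_Bianchi Rm) :
  (scalar_part (iter_contraction e n (dexp Rm k)) / n`!%:R) *: metric_form g
  - ((n - 1)`!%:R)^-1 *: iter_contraction e (n - 1) (dexp Rm k) = 0.
Proof.
have e_basis : basis_of fullv e by have /andP[] := e_onb.
have e_uniq : uniq e by rewrite free_uniq// (basis_free e_basis).
have sze : size e = n by rewrite -dimV (size_basis (X := in_tuple e)).
(* Evenness enters here: [k] factors of bidegree (2,2) reach exactly the top degree. *)
have Rk_form : is_double_form (size e) (size e) (dexp Rm k).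
  by rewrite sze n_even mulnC; apply: dexp_is_double_form.
(* With [n = m.+1], the full contraction is one more contraction of the (1,1) form [w] below. *)
case: n n_ge2 {dimV n_even} sze => // m _ sze; rewrite subn1 /=.
set w := iter_contraction e m (dexp Rm k).
have w_form : is_double_form 1 1 w.
  by apply: iter_contraction_is_double_form; rewrite addn1 -sze.
have w_bal : balanced_on e w.
  by apply: iter_contraction_balanced; apply: top_form_balanced.
have w_diag : {in e &, forall a b, w [:: a] [:: a] = w [:: b] [:: b]}.
  apply: diag_invariant_swap => // f injf fe.
  by apply: iter_contraction_diag_invariant => //; apply: top_form_diag_invariant.
have [v ve] : exists v, v \in e.
  by case: (e) sze => // v s _; exists v; rewrite mem_head.
pose c := w [:: v] [:: v].
(* The trace adds [m.+1] diagonal entries, all equal to [c] by [w_diag]. *)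
have trE : scalar_part (contraction e w) = c *+ m.+1.
  rewrite /scalar_part /contraction big_seq (eq_bigr (fun=> c)) => [|u ue].
    by rewrite -big_seq big_const_seq count_predT sze iter_addr_0.
  exact: w_diag.
rewrite trE.
have -> : w = c *: metric_form g.
  apply: (double_form11_scalar e_onb) => // a b ae be.
  have [<-|ab] := eqVneq a b; first by rewrite mulr1; apply: w_diag.
  rewrite mulr0 w_bal ?all_seq1//; apply: contra ab => /perm_mem/(_ a).
  by rewrite !inE eqxx => <-.
(* Both coefficients of the metric equal [c / m!]: the factor [m.+1] from the trace cancels against
   the one in [m.+1] factorial. *)
rewrite scalerA -scalerBl -[c *+ _]mulr_natr factS natrM invfM.
rewrite [in X in X - _]mulrA mulfK ?pnatr_eq0// [c * _]mulrC subrr.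
exact: scale0r.
Qed.
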